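(* Let $0\le k\le n$, let $v\in S_n$ be $k$-Grassmannian and let $u\le v$ in Bruhat order, so that $[u,v]$ is a Grassmann interval. Assume $A\in\Pi_{[u,v]}\subseteq Gr(k,n)$ is the image under $\pi_k$ of a point of $C_y\cap X^v$ for some $y\in[u,v]$. Then the codimension of the tangent space to $\Pi_{[u,v]}$ at $A$ is bounded below by $\operatorname{rank}(Jac|_{A_{y[k]}})$, i.e. $\operatorname{rank}(Jac|_A)\ge \operatorname{rank}(Jac|_{A_{y[k]}})$.
   Context: Permutations: $[n]=\{1,\dots,n\}$, $\binom{[n]}{k}$ is the set of $k$-subsets of $[n]$. For $w\in S_n$, $w_i=w(i)$ and $w[i]=\{w_1,\dots,w_i\}$. For $k$-subsets $I=\{i_1<\dots<i_k\}$, $J=\{j_1<\dots<j_k\}$ write $I\preceq J$ if $i_h\le j_h$ for all $h$. Bruhat order: $u\le v$ iff $u[i]\preceq v[i]$ for all $i\in[n]$; $[u,v]=\{y\in S_n: u\le y\le v\}$. A permutation $v$ is $k$-Grassmannian if $v_1<\dots<v_k$ and $v_{k+1}<\dots<v_n$. A Grassmann interval is an interval $[u,v]$ with $v$ $k$-Grassmannian. Flags: a point $V_\bullet=(0\subset V_1\subset\dots\subset V_n=\mathbb C^n)$ of the complete flag variety $\mathcal F\ell(n)$ is represented by an invertible $n\times n$ complex matrix whose first $i$ rows span $V_i$. For $J\subseteq[n]$, $\mathrm{Proj}_J:\mathbb C^n\to\mathbb C^{|J|}$ is the projection onto the coordinates in $J$. The Schubert cell is $C_w=\{V_\bullet:\dim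 \mathrm{Proj}_{[j]}(V_i)=|w[i]\cap[j]|\ \forall i,j\}$ and $X_w=\{V_\bullet:\dim \mathrm{Proj}_{[j]}(V_i)\le|w[i]\cap[j]|\ \forall i,j\}$ is its closure (Schubert variety). The opposite Schubert variety is $X^w=\{V_\bullet:\dim \mathrm{Proj}_{[n-j+1,n]}(V_i)\le|w[i]\cap[n-j+1,n]|\ \forall i,j\}$. $X_u^v=X_u\cap X^v=\bigsqcup_{u\le y\le v}(C_y\cap X^v)$. The map $\pi_k:\mathcal F\ell(n)\to Gr(k,n)$ sends $V_\bullet$ to $V_k$. Positroid variety: $Gr(k,n)$ is the complex Grassmannian of $k$-dimensional subspaces of $\mathbb C^n$, a point being the row span of a full rank $k\times n$ matrix. The positroid variety of $[u,v]$ is $\Pi_{[u,v]}=\pi_k(X_u^v)$. Let $\mathcal M$ be the positroid corresponding to $[u,v]$ (the set of those $I\in\binom{[n]}{k}$ for which the maximal minor $\Delta_I$ in columns $I$ does not vanish identically on $\Pi_{[u,v]}$), and $\mathcal Q=\binom{[n]}{k}\setminus\mathcal M$. It is known that the vanishing ideal of $\Pi_{[u,v]}$ is generated by $\{\Delta_I: I\in\mathcal Q\}$. $Jac$ is the matrix with rows indexed by $I\in\mathcal Q$, columns indexed by the variables $x_{ij}$ ($i\in[k],j\in[n]$) and entries $\partial\Delta_I/\partial x_{ij}$; $Jac|_A$ is its evaluation at a full rank $k\times n$ matrix $A$ representing a point. Its rank depends only on the point represented, and $\operatorname{rank}(Jac|_A)$ is the codimension of the tangent space to $\Pi_{[u,v]}$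 at $A$. For $J=\{j_1,\dots,j_k\}\subseteq[n]$, $A_J\in Gr(k,n)$ is the coordinate subspace spanned by $e_j$, $j\in J$, represented by the $k\times n$ matrix with a $1$ in each cell $(i,j_i)$ and zeros elsewhere. *)

(* Defs.v *)
From mathcomp Require Import all_boot all_order all_algebra all_fingroup.
From mathcomp Require Import complex mpoly.
From mathcomp Require Import boolp reals.
Set Implicit Arguments.
Unset Strict Implicit.
Unset Printing Implicit Defensive.
Import GRing.Theory.
Local Open Scope ring_scope.

(* [n] = {1, ..., n} is encoded as 'I_n = {0, ..., n - 1}: the element m of   *)
(* [n] is the ordinal of value m - 1, so that [j] is {h : 'I_n | h < j} and   *)
(* [n - j + 1, n] is {h : 'I_n | n - j <= h}.                                 *)

Definition ksubset (n k : nat) := {I : {set 'I_n} | #|I| == k}.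

Lemma card_ksubset n k (I : ksubset n k) : k = #|sval I|.
Proof. by rewrite (eqP (svalP I)). Qed.

(* The h-th smallest element of I; enum_val lists ordinals increasingly. *)
Definition kth n k (I : ksubset n k) (h : 'I_k) : 'I_n :=
  enum_val (cast_ord (card_ksubset I) h).

Definition preceq n k (I J : ksubset n k) : Prop :=
  forall h : 'I_k, (kth I h <= kth J h)%N.

Definition low_set n (j : nat) : {set 'I_n} := [set h : 'I_n | (h < j)%N].
Definition high_set n (j : nat) : {set 'I_n} := [set h : 'I_n | (n - j <= h)%N].

(* w[i] = {w_1, ..., w_i} *)
Definition initial n (w : 'S_n) (i : nat) : {set 'I_n} :=
  [set w h | h in low_set n i].

Lemma card_initial n (w : 'S_n) i : (i <= n)%N -> #|initial w i| == i.
Proof.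
move=> le_in; rewrite card_imset; last exact: perm_inj.
have -> : low_set n i = [set widen_ord le_in h | h : 'I_i].
  apply/setP=> h; rewrite inE; apply/idP/imsetP => [lt_hi | [g _ ->]] //=.
  by exists (Ordinal lt_hi) => //; apply: val_inj.
by rewrite card_imset ?card_ord // => g h /(congr1 val) /= /val_inj.
Qed.

Definition kinitial n (w : 'S_n) i (le_in : (i <= n)%N) : ksubset n i :=
  exist _ (initial w i) (card_initial w le_in).

Definition bruhat_le n (u v : 'S_n) : Prop :=
  forall (i : nat) (le_in : (i <= n)%N),
    preceq (kinitial u le_in) (kinitial v le_in).

Definition grassmannian n (k : nat) (v : 'S_n) : Prop :=
  forall i j : 'I_n, (i < j)%N -> (j < k)%N || (k <= i)%N -> (v i < v j)%N.

Section Flags.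
Variables (K : fieldType) (n : nat).

(* A flag is represented by an invertible matrix F; flag_space F i is a       *)
(* matrix whose row space is V_i, the span of the first i rows of F.          *)
Definition flag_space (F : 'M[K]_n) (i : nat) : 'M[K]_n :=
  (\sum_(h < n | (h < i)%N) <<row h F>>)%MS.

(* Proj_J, applied to each row of V *)
Definition proj (J : {set 'I_n}) m (V : 'M[K]_(m, n)) : 'M[K]_(m, #|J|) :=
  colsub (fun h : 'I_#|J| => enum_val h) V.

Definition schubert_cell (w : 'S_n) (F : 'M[K]_n) : Prop :=
  F \in unitmx /\
  forall i j, (i <= n)%N -> (j <= n)%N ->
    \rank (proj (low_set n j) (flag_space F i))
      = #|initial w i :&: low_set n j|.

Definition schubert_variety (w : 'S_n) (F : 'M[K]_n) : Prop :=
  F \in unitmx /\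
  forall i j, (i <= n)%N -> (j <= n)%N ->
    (\rank (proj (low_set n j) (flag_space F i))
      <= #|initial w i :&: low_set n j|)%N.

Definition opposite_schubert_variety (w : 'S_n) (F : 'M[K]_n) : Prop :=
  F \in unitmx /\
  forall i j, (i <= n)%N -> (j <= n)%N ->
    (\rank (proj (high_set n j) (flag_space F i))
      <= #|initial w i :&: high_set n j|)%N.

Definition richardson_variety (u v : 'S_n) (F : 'M[K]_n) : Prop :=
  schubert_variety u F /\ opposite_schubert_variety v F.

Variable k : nat.

(* The full rank k x n matrix A represents the point pi_k(F) = V_k of         *)
(* Gr(k, n).                                                                  *)
Definition represents_pi (F : 'M[K]_n) (A : 'M[K]_(k, n)) : Prop :=
  row_free A /\ (A == flag_space F k)%MS.

(* The set of full rank matrices representing the points of Pi_[u, v] *)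
Definition positroid_variety (u v : 'S_n) (A : 'M[K]_(k, n)) : Prop :=
  exists2 F : 'M[K]_n, richardson_variety u v F & represents_pi F A.

End Flags.

(* Delta_I; R is a field for values at points, a polynomial ring for Jac *)
Definition minor (R : comNzRingType) n k (I : ksubset n k)
    (A : 'M[R]_(k, n)) : R :=
  \det (colsub (kth I) A).

Definition coord_point (K : fieldType) n k (J : ksubset n k) : 'M[K]_(k, n) :=
  \matrix_(i, j) (j == kth J i)%:R.

Section Jacobian.
Variables (K : fieldType) (n k : nat) (u v : 'S_n).

Definition in_positroid (I : ksubset n k) : Prop :=
  exists2 A : 'M[K]_(k, n), positroid_variety u v A & minor I A != 0.

Definition nonbases : {set ksubset n k} :=
  [set I : ksubset n k | ~~ `[< in_positroid I >]].

(* The variable x_ij is the one of index mxvec_index i j among the k * n      *)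
(* variables of {mpoly K[k * n]}.                                             *)
Definition generic_matrix : 'M[{mpoly K[k * n]}]_(k, n) :=
  \matrix_(i, j) 'X_(mxvec_index i j).

Definition eval_at (A : 'M[K]_(k, n)) (p : {mpoly K[k * n]}) : K :=
  p.@[fun c => mxvec A 0 c].

Definition Jac : 'M[{mpoly K[k * n]}]_(#|nonbases|, k * n) :=
  \matrix_(r, c) (minor (enum_val r) generic_matrix)^`M(c).

Definition Jac_at (A : 'M[K]_(k, n)) : 'M[K]_(#|nonbases|, k * n) :=
  map_mx (eval_at A) Jac.

Definition vanishing_ideal (p : {mpoly K[k * n]}) : Prop :=
  forall A : 'M[K]_(k, n), positroid_variety u v A -> eval_at A p = 0.

(* T is the Zariski tangent space at A, in the k x n matrices, to the set of  *)
(* matrices representing points of Pi_[u, v]. That set is the preimage of     *)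
(* Pi_[u, v] under the smooth map sending a full rank matrix to its row span, *)
(* so the codimension of T in the k x n matrices is that of the tangent space *)
(* to Pi_[u, v] in the tangent space to Gr(k, n).                             *)
Definition is_tangent_space (A : 'M[K]_(k, n)) (T : {vspace 'M[K]_(k, n)}) :
    Prop :=
  forall B : 'M[K]_(k, n),
    B \in T <->
    (forall p, vanishing_ideal p ->
       \sum_(i < k) \sum_(j < n)
         eval_at A (p^`M(mxvec_index i j)) * B i j = 0).

End Jacobian.

(* Main.v *)
Require Import Defs.
From mathcomp Require Import all_boot all_order all_algebra all_fingroup.
From mathcomp Require Import complex mpoly.
From mathcomp Require Import boolp reals.
Import GRing.Theory.
Local Open Scope ring_scope.

(** The rank of the Jacobian does not change along a torus orbit and can only
    drop in the limit, and the coordinate point of y[k] is such a limit of A.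

    If the flag of A lies in the Schubert cell of y, the first j columns of A
    have rank |y[k] :&: [j]| for every j. So the pivot columns of A are those
    of y[k]: a change of basis g puts A in echelon form with pivots
    y[k] = {j_1 < ... < j_k} ([echelon_form]). Multiplying column j by t^j and
    row i by t^-j_i turns each entry of g A in a cell (i, j) with j >= j_i into
    its multiple by t^(j - j_i), while the entries to the left of the pivots
    are 0. The result is polynomial in t, and at t = 0 only the pivots remain:
    it is the coordinate point of y[k] ([degeneration0]).

    A minor of g A diag(d) is the corresponding minor of A times a constant
    that does not involve A. By the chain rule the Jacobian at g A diag(d) is
    that at A up to invertible factors on both sides, so the rank does not
    decrease ([rank_Jac_at_scale_le]). On the other hand a minor of the Jacobian
    that does not vanish at t = 0 does not vanish at a general t
    ([rank_specialize_le]). Together these give the inequality of ranks.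

    For the codimension of the tangent space T, the minors indexed by
    nonbases vanish on the positroid variety, so every row of the Jacobian at A
    is a linear equation of T ([rank_Jac_at_le_codim]). *)

(** * Derivatives of minors *)

Lemma mmap_minor_generic (K : fieldType) (S : comNzRingType)
    (f : {rmorphism K -> S}) n k (I : ksubset n k) (M : 'M[S]_(k, n)) :
  mmap f (fun c => mxvec M 0 c) (minor I (generic_matrix K n k)) = minor I M.
Proof.
rewrite /minor -det_map_mx; congr (\det _); apply/matrixP=> i h.
by rewrite 3!mxE /= mmapX mmap1U mxvecE mxE.
Qed.

Lemma eval_minor_generic (K : fieldType) n k (I : ksubset n k)
    (A : 'M[K]_(k, n)) : eval_at A (minor I (generic_matrix K n k)) = minor I A.
Proof. exact: (mmap_minor_generic K K idfun). Qed.

(** Evaluation on the line v + w 'X, taken modulo 'X^2, is evaluation at dual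
    numbers. So its coefficients of degree 0 and 1 are the value at v and a
    derivation; two such K-linear pairs agree as soon as they agree on the
    variables. *)
Lemma coef1_mmap_line (K : fieldType) N (v w : 'I_N -> K) (p : {mpoly K[N]}) :
  (mmap polyC (fun c => (v c)%:P + w c *: 'X) p)`_1 =
    \sum_c (p^`M(c)).@[v] * w c.
Proof.
set L := mmap _ _.
pose D (p : {mpoly K[N]}) := \sum_c (p^`M(c)).@[v] * w c.
have LM q r : L (q * r) = L q * L r by rewrite /L rmorphM.
suff: (L p)`_0 = p.@[v] /\ (L p)`_1 = D p by case.
have line_mul q r : (L q)`_0 = q.@[v] /\ (L q)`_1 = D q ->
    (L r)`_0 = r.@[v] /\ (L r)`_1 = D r ->
    (L (q * r))`_0 = (q * r).@[v] /\ (L (q * r))`_1 = D (q * r).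
  move=> [q0 q1] [r0 r1]; rewrite LM !coefM !big_ord_recl !big_ord0 /=.
  rewrite /bump /= !subn0 subnn !addr0 q0 q1 r0 r1 mevalM; split=> //.
  rewrite addrC /D [X in X + _]mulr_suml [X in _ + X]mulr_sumr -big_split.
  apply: eq_bigr => c _ /=.
  by rewrite mderivM mevalD !mevalM mulrDl mulrAC mulrA.
have line1 : (L 1)`_0 = 1.@[v] /\ (L 1)`_1 = D 1.
  rewrite /L rmorph1 meval1 !coefC; split=> //=.
  by rewrite /D big1 // => c _; rewrite -mpolyC1 mderivC meval0 mul0r.
elim/mpolyind: p => [|c m p _ _ [p0 p1]].
  rewrite /L mmap0 meval0 !coef0; split=> //.
  by rewrite /D big1 // => c _; rewrite mderiv0 meval0 mul0r.
have [m0 m1] : (L 'X_[m])`_0 = 'X_[m].@[v] /\ (L 'X_[m])`_1 = D 'X_[m].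
  rewrite mpolyXE_id.
  elim/big_ind: _ => //= i _; elim: (m i) => [|e IHe]; first by rewrite expr0.
  rewrite exprS; apply: line_mul => //.
  rewrite [L _]mmapX mmap1U mevalXU !coefD !coefZ !coefC !coefX /= mulr0 mulr1.
  rewrite addr0 add0r; split=> //; rewrite /D (bigD1 i) //= big1 => [|l nli].
    rewrite mderivX mnm1E eqxx -{1}[U_(i)%MM]add0m addmK mpolyX0 scale1r.
    by rewrite meval1 mul1r addr0.
  by rewrite mderivX mnm1E eq_sym (negbTE nli) scale0r meval0 mul0r.
rewrite /L mmapD mmapZ !coefD !coefCM -/L p0 p1 m0 m1 mevalD mevalZ; split=> //.
rewrite /D mulr_sumr -big_split; apply: eq_bigr => i _ /=.
by rewrite mderivD mderivZ mevalD mevalZ mulrDl mulrA.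
Qed.

Definition line {K : fieldType} {k n} (A B : 'M[K]_(k, n)) :
    'M[{poly K}]_(k, n) :=
  map_mx polyC A + 'X *: map_mx polyC B.

(** Reading the Jacobian as the linear map B |-> d/dX minor (A + X B) at 0 is
    what makes the chain rule below a computation with determinants. *)
Lemma Jac_at_mul (K : fieldType) n k (u v : 'S_n) (A B : 'M[K]_(k, n)) r :
  (Jac_at u v A *m (mxvec B)^T) r 0 = (minor (enum_val r) (line A B))`_1.
Proof.
rewrite -(mmap_minor_generic _ _ polyC).
rewrite (_ : mmap _ _ _ = mmap polyC
    (fun c => (mxvec A 0 c)%:P + mxvec B 0 c *: 'X)
    (minor (enum_val r) (generic_matrix K n k))); last first.
  apply: eq_bigr => m _; congr (_ * _); apply: mmap1_eq => c.
  by case/mxvec_indexP: c => i j; rewrite !mxvecE !mxE mulrC mul_polyC.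
rewrite coef1_mmap_line mxE; apply: eq_bigr => c _.
by rewrite !mxE.
Qed.

Lemma minor_mul (S : comNzRingType) n k (I : ksubset n k) (g : 'M[S]_k)
    (A : 'M[S]_(k, n)) (d : 'rV[S]_n) :
  minor I (g *m A *m diag_mx d) = \det g * (\prod_h d 0 (kth I h)) * minor I A.
Proof.
rewrite /minor -mulrA [_ * \det (colsub _ _)]mulrC mulrA -det_mulmx.
rewrite (_ : \prod_h _ = \det (diag_mx (\row_h d 0 (kth I h)))).
  rewrite -det_mulmx mulmx_colsub; congr (\det _).
  by apply/matrixP=> i h; rewrite !mul_mx_diag !mxE.
by rewrite det_diag; apply: eq_bigr => h _; rewrite mxE.
Qed.

(** Every minor is an eigenfunction of the group GL_k x torus acting by
    A |-> g A diag(d). So differentiating the minors at g A diag(d) along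
    g B diag(d) gives the derivatives at A along B, up to a nonzero factor in
    each row of the Jacobian. *)
Lemma rank_Jac_at_scale_le (K : fieldType) n k (u v : 'S_n) (g : 'M[K]_k)
    (A : 'M[K]_(k, n)) (d : 'rV[K]_n) :
  g \in unitmx -> (forall j, d 0 j != 0) ->
  (\rank (Jac_at u v A) <= \rank (Jac_at u v (g *m A *m diag_mx d)))%N.
Proof.
move=> g_unit d_neq0; set J' := Jac_at u v (_ *m _).
pose c := \row_(r < #|nonbases K k u v|)
  (\det g * \prod_h d 0 (kth (enum_val r) h)).
pose act := mulmx g \o mulmxr (diag_mx d).
pose G := lin_mx act.
have chain_rule : diag_mx c *m Jac_at u v A = J' *m G^T.
  have ext (M M' : 'M[K]_(#|nonbases K k u v|, k * n)) :
      (forall B : 'M[K]_(k, n), M *m (mxvec B)^T = M' *m (mxvec B)^T) -> M = M'.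
    move=> eqM; rewrite -[M]trmxK -[M']trmxK; congr _^T; apply/row_matrixP=> l.
    rewrite 2!rowE -[delta_mx 0 l]vec_mxK -[LHS]trmxK -[RHS]trmxK.
    by rewrite !(trmx_mul (mxvec _)) !trmxK eqM.
  apply: ext => B; apply/colP=> r.
  rewrite -!mulmxA -trmx_mul mul_vec_lin /= mul_diag_mx [LHS]mxE.
  rewrite !Jac_at_mul.
  rewrite (_ : line (g *m _ *m _) _ =
    map_mx polyC g *m line A B *m diag_mx (map_mx polyC d)).
    rewrite minor_mul det_map_mx.
    rewrite (_ : \prod_h _ = (\prod_h d 0 (kth (enum_val r) h))%:P).
      by rewrite -polyCM coefCM mxE.
    by rewrite rmorph_prod /=; apply: eq_bigr => h _; rewrite mxE.
  rewrite /line mulmxDr mulmxDl -scalemxAr -scalemxAl -map_diag_mx -!map_mxM.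
  by rewrite mulmxA.
have c_unit : diag_mx c \in unitmx.
  rewrite unitmxE det_diag unitfE; apply/prodf_neq0 => r _.
  rewrite mxE mulf_neq0 //; first by rewrite -unitfE -unitmxE.
  by apply/prodf_neq0.
have c_full : row_full (diag_mx c) by rewrite row_full_unit.
by rewrite -(eqmxMfull _ c_full) chain_rule mxrankM_maxl.
Qed.

(** * Semicontinuity of the rank *)

Lemma poly_nonroot_neq0 (K : numFieldType) (p : {poly K}) :
  p != 0 -> exists2 t : K, t != 0 & p.[t] != 0.
Proof.
move=> p_neq0; pose s := [seq (i.+1)%:R : K | i <- iota 0 (size p)].
have s_uniq : uniq s.
  rewrite map_inj_uniq ?iota_uniq // => i j /eqP.
  by rewrite Num.Theory.eqr_nat eqSS => /eqP.
have : ~~ all (root p) s.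
  apply/negP=> /(max_poly_roots p_neq0) /(_ s_uniq).
  by rewrite size_map size_iota ltnn.
case/allPn=> _ /mapP[i _ ->] nroot; exists i.+1%:R => //.
by rewrite Num.Theory.pnatr_eq0.
Qed.

(** With r the rank at 0, matrices L and S over the field bring the value at 0
    to the r x r identity. The determinant of L N S is then a polynomial equal
    to 1 at 0, and N has rank at least r wherever it does not vanish. *)
Lemma rank_specialize_le (K : numFieldType) m p (N : 'M[{poly K}]_(m, p)) :
  exists2 t : K, t != 0 &
    (\rank (map_mx (horner_eval 0) N) <= \rank (map_mx (horner_eval t) N))%N.
Proof.
set N0 := map_mx _ N.
pose L := pinvmx (col_base N0); pose S := pinvmx (row_base N0).
have LN0S : L *m N0 *m S = 1%:M.
  have -> : L *m N0 = L *m (col_base N0 *m row_base N0) by rewrite mulmx_base.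
  by rewrite mulmxA mulVpmx ?col_base_full // mul1mx mulmxVp ?row_base_free.
pose q := \det (map_mx polyC L *m N *m map_mx polyC S).
have qE t : q.[t] = \det (L *m map_mx (horner_eval t) N *m S).
  have evalC a b (M : 'M[K]_(a, b)) :
      map_mx (horner_eval t) (map_mx polyC M) = M.
    by apply/matrixP=> i j; rewrite !mxE; exact: hornerC.
  by rewrite -horner_evalE /q -det_map_mx !map_mxM !evalC.
have q_neq0 : q != 0.
  apply: contra_eq_neq (qE 0) => ->.
  by rewrite horner0 LN0S det1 eq_sym oner_eq0.
have [t t_neq0 qt_neq0] := poly_nonroot_neq0 K q q_neq0; exists t => //.
move: qt_neq0; rewrite qE -unitfE -unitmxE => /mxrank_unit eq_rank.
rewrite -[leqLHS]eq_rank.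
exact: leq_trans (mxrankM_maxl _ _) (mxrankM_maxr _ _).
Qed.

Lemma rank_Jac_at_specialize_le (K : numFieldType) n k (u v : 'S_n)
    (P : 'M[{poly K}]_(k, n)) :
  exists2 t : K, t != 0 &
    (\rank (Jac_at u v (map_mx (horner_eval 0) P))
      <= \rank (Jac_at u v (map_mx (horner_eval t) P)))%N.
Proof.
pose N := map_mx (mmap polyC (fun c => mxvec P 0 c)) (@Jac K n k u v).
have NE t : map_mx (horner_eval t) N = Jac_at u v (map_mx (horner_eval t) P).
  rewrite /Jac_at -map_mx_comp; apply: eq_map_mx => p /=.
  rewrite rmorph_sum; apply: eq_bigr => m _.
  rewrite rmorphM /= horner_evalE hornerC; congr (_ * _).
  rewrite rmorph_prod; apply: eq_bigr => c _.
  by rewrite rmorphXn /=; case/mxvec_indexP: c => i j; rewrite !mxvecE mxE.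
by have [t t_neq0] := rank_specialize_le K _ _ N; rewrite !NE => ?; exists t.
Qed.

(** * Degeneration of an echelon form to a coordinate point *)

Lemma kth_mono n k (I : ksubset n k) (h i : 'I_k) :
  (h < i)%N -> (kth I h < kth I i)%N.
Proof.
move=> lt_hi; rewrite /kth /enum_val.
set h' := cast_ord _ h; set i' := cast_ord _ i.
have lt_h : (h' < size (enum (sval I)))%N by rewrite -cardE.
have lt_i : (i' < size (enum (sval I)))%N by rewrite -cardE.
rewrite (set_nth_default (enum_default h') (enum_default i') lt_i).
have enum_sorted : sorted (relpre val ltn) (enum (sval I)).
  rewrite {1}/enum_mem; apply: sorted_filter => [a b c|].
    exact: ltn_trans.
  by rewrite -enumT -sorted_map val_enum_ord iota_ltn_sorted.
by apply: (sorted_ltn_nth _ _ enum_sorted) => // [a b c]; apply: ltn_trans.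
Qed.

Lemma mem_kth n k (I : ksubset n k) (h : 'I_k) : kth I h \in sval I.
Proof. exact: enum_valP. Qed.

Definition echelon {K : fieldType} {n k} (J : ksubset n k)
    (A : 'M[K]_(k, n)) :=
  forall i, A i (kth J i) = 1 /\ forall j : 'I_n, (j < kth J i)%N -> A i j = 0.

(** When A is in echelon form, its value at t != 0 is A with row i divided by
    t ^ (kth J i) and column j multiplied by t ^ j: the truncation of the
    exponent is harmless, since the entries with j < kth J i vanish. *)
Definition degeneration {K : fieldType} {n k} (J : ksubset n k)
    (A : 'M[K]_(k, n)) : 'M[{poly K}]_(k, n) :=
  \matrix_(i, j) (A i j *: 'X^(j - kth J i)).

Lemma degeneration0 (K : fieldType) n k (J : ksubset n k) (A : 'M[K]_(k, n)) :
  echelon J A -> map_mx (horner_eval 0) (degeneration J A) = coord_point K J.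
Proof.
move=> ech; apply/matrixP=> i j; have [Ai1 Ai0] := ech i.
rewrite !mxE horner_evalE hornerZ hornerXn expr0n subn_eq0.
have [lt_j | lt_j | eq_j] := ltngtP j (kth J i).
- by rewrite Ai0 // mul0r; case: eqP lt_j => // ->; rewrite ltnn.
- by rewrite mulr0; case: eqP lt_j => // ->; rewrite ltnn.
- by rewrite (val_inj eq_j) Ai1 eqxx mulr1.
Qed.

Lemma degenerationE (K : fieldType) n k (J : ksubset n k) (A : 'M[K]_(k, n))
    (t : K) : echelon J A -> t != 0 ->
  map_mx (horner_eval t) (degeneration J A) =
    diag_mx (\row_i t ^- kth J i) *m A *m diag_mx (\row_j t ^+ j).
Proof.
move=> ech t_neq0; apply/matrixP=> i j; have [_ Ai0] := ech i.
rewrite mul_mx_diag mul_diag_mx !mxE horner_evalE hornerZ hornerXn.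
have [lt_j | le_j] := ltnP j (kth J i); first by rewrite Ai0 // !(mul0r, mulr0).
by rewrite expfB_cond ?(negbTE t_neq0) // mulrCA [RHS]mulrC [_ * A i j]mulrC.
Qed.

(** The point at t = 0 of the degeneration is the coordinate point, while the
    points at t != 0 are obtained from A by invertible row and column scalings. *)
Lemma rank_Jac_at_coord_le (K : numFieldType) n k (u v : 'S_n)
    (J : ksubset n k) (A : 'M[K]_(k, n)) :
  echelon J A ->
  (\rank (Jac_at u v (coord_point K J)) <= \rank (Jac_at u v A))%N.
Proof.
move=> ech.
have [t t_neq0] := rank_Jac_at_specialize_le K n k u v (degeneration J A).
rewrite degeneration0 // degenerationE // => /leq_trans; apply.
set a := \row_i _; set d := \row_j _.
(* a' and d' undo the scalings a and d. *)
pose a' : 'rV[K]_k := \row_i t ^+ kth J i.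
pose d' : 'rV[K]_n := \row_j t ^- j.
have a'_unit : diag_mx a' \in unitmx.
  rewrite unitmxE det_diag unitfE; apply/prodf_neq0 => i _.
  by rewrite mxE expf_neq0.
have d'_neq0 j : d' 0 j != 0 by rewrite mxE invr_neq0 ?expf_neq0.
have := rank_Jac_at_scale_le K n k u v _ (diag_mx a *m A *m diag_mx d) _
  a'_unit d'_neq0.
rewrite (_ : diag_mx a' *m _ *m diag_mx d' = A) //.
apply/matrixP=> i j; rewrite !(mul_mx_diag, mul_diag_mx) !mxE.
by rewrite -!mulrA mulVKf ?divff ?mulr1 ?expf_neq0.
Qed.

(** * Echelon form of a point of a Schubert cell *)

Lemma proj_mul (K : fieldType) n (J : {set 'I_n}) m p (g : 'M[K]_(p, m))
    (V : 'M[K]_(m, n)) : proj J (g *m V) = g *m proj J V.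
Proof. by rewrite /proj mulmx_colsub. Qed.

Lemma rank_proj_eqmx (K : fieldType) n (J : {set 'I_n}) m p (U : 'M[K]_(m, n))
    (V : 'M[K]_(p, n)) : (U == V)%MS -> \rank (proj J U) = \rank (proj J V).
Proof.
move/eqmxP=> eqUV.
rewrite -[U]mulmx1 -[V]mulmx1 !proj_mul.
by rewrite (eqmxMr _ eqUV).
Qed.

Lemma proj_eq0 (K : fieldType) n (J : {set 'I_n}) (r : 'rV[K]_n) :
  proj J r = 0 -> forall l, l \in J -> r 0 l = 0.
Proof.
move=> /rowP r0 l Jl; have := r0 (enum_rank_in Jl l).
by rewrite !mxE enum_rankK_in.
Qed.

(** Column j is not a combination of the columns before it, so some linear
    form on the columns kills the latter but not the former. *)
Lemma pivot_functional (K : fieldType) n k (A : 'M[K]_(k, n)) (j : 'I_n) :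
  (\rank (proj (low_set n j) A) < \rank (proj (low_set n j.+1) A))%N ->
  exists g : 'rV[K]_k,
    (g *m A) 0 j = 1 /\ forall l : 'I_n, (l < j)%N -> (g *m A) 0 l = 0.
Proof.
set Y := proj _ A; set X := proj _ A => lt_rank.
have : kermx Y *m X != 0.
  apply: contraTneq lt_rank => /eqP; rewrite -sub_kermx => /mxrankS.
  rewrite !mxrank_ker -leqNgt => le_ker.
  by rewrite -(leq_sub2lE _ (rank_leq_row X)).
move=> nz; have [i nzi] : exists i, row i (kermx Y) *m X != 0.
  apply/existsP; apply: contraNT nz; rewrite negb_exists => /forallP z.
  by apply/eqP/row_matrixP=> i; rewrite row_mul row0; apply/eqP/negPn/z.
pose g := row i (kermx Y).
have gY0 : proj (low_set n j) (g *m A) = 0.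
  by rewrite proj_mul -row_mul mulmx_ker row0.
have gA0 (l : 'I_n) : (l < j)%N -> (g *m A) 0 l = 0.
  by move=> lt_lj; apply: (proj_eq0 _ _ _ _ gY0); rewrite inE.
have gAj : (g *m A) 0 j != 0.
  apply: contraNneq nzi => gAj0; rewrite -proj_mul; apply/eqP/rowP=> c.
  rewrite mxE [RHS]mxE; have := enum_valP c; rewrite inE ltnS leq_eqVlt.
  by case/predU1P => [/val_inj -> | /gA0].
exists (((g *m A) 0 j)^-1 *: g); rewrite -scalemxAl; split=> [|l lt_lj].
  by rewrite mxE mulVf.
by rewrite mxE (gA0 l) ?mulr0.
Qed.

Lemma echelon_form (K : fieldType) n k (J : ksubset n k) (A : 'M[K]_(k, n)) :
  (forall j, (j <= n)%N ->
     \rank (proj (low_set n j) A) = #|sval J :&: low_set n j|) ->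
  exists g : 'M[K]_k, echelon J (g *m A).
Proof.
move=> rankA.
have pivot i : exists g : 'rV[K]_k, (g *m A) 0 (kth J i) = 1 /\
    forall l : 'I_n, (l < kth J i)%N -> (g *m A) 0 l = 0.
  apply: pivot_functional; rewrite !rankA // ?(ltnW (ltn_ord _)) //.
  apply: proper_card; apply/properP; split.
    by apply/subsetP=> l; rewrite !inE => /andP[-> /ltnW].
  by exists (kth J i); rewrite !inE ?mem_kth ?ltnS ?leqnn ?ltnn ?andbF.
have [g gP] := choice pivot.
exists (\matrix_i g i) => i; have [gi1 gi0] := gP i.
have giE l : ((\matrix_i g i) *m A) i l = (g i *m A) 0 l.
  by rewrite -[g i](rowK g) -row_mul [RHS]mxE.
by rewrite giE; split=> // l; rewrite giE; apply: gi0.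
Qed.

(** The pivot columns of g A form a unitriangular matrix, and g divides it. *)
Lemma echelon_mul_unit (K : fieldType) n k (J : ksubset n k)
    (g : 'M[K]_k) (A : 'M[K]_(k, n)) : echelon J (g *m A) -> g \in unitmx.
Proof.
move=> ech; pose U := colsub (kth J) (g *m A).
have det1 : \det U = 1.
  rewrite -det_tr det_trig.
    by rewrite big1 // => i _; rewrite 2!mxE; case: (ech i).
  apply/is_trig_mxP => i h lt_ih; rewrite mxE [LHS]mxE.
  by have [_ ->] := ech h; last exact: kth_mono.
move: (oner_neq0 K); rewrite -det1 /U -mulmx_colsub det_mulmx mulf_eq0 negb_or.
by case/andP; rewrite unitmxE unitfE.
Qed.

(** * The tangent space *)

(** A subspace of largest dimension among those inside P contains every x of
    P, since otherwise adding x to it would give a larger one. *)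
Lemma vspace_of_linear_closed (K : fieldType) (vT : vectType K)
    (P : vT -> Prop) :
  P 0 -> (forall a x y, P x -> P y -> P (a *: x + y)) ->
  exists T : {vspace vT}, forall x, x \in T <-> P x.
Proof.
move=> P0 Plin.
pose dim_in d :=
  `[< exists2 T : {vspace vT}, forall x, x \in T -> P x & \dim T = d >].
have ex_dim : exists d, dim_in d.
  exists 0%N; apply/asboolP; exists 0%VS => [x|]; last exact: dimv0.
  by rewrite memv0 => /eqP->.
have ub_dim d : dim_in d -> (d <= \dim {:vT})%N.
  by case/asboolP=> T _ <-; apply/dimvS/subvf.
case: (ex_maxnP ex_dim ub_dim) => d /asboolP[T TP dimT] maxT.
exists T => x; split=> [/TP // | Px].
have : dim_in (\dim (<[x]> + T)).
  apply/asboolP; exists (<[x]> + T)%VS => // z.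
  move=> /memv_addP[_ /vlineP[a ->] [t /TP Pt ->]].
  exact: Plin.
move/maxT; rewrite -dimT => le_dim.
have /eqP -> : (T == <[x]> + T)%VS by rewrite eqEdim addvSr.
by rewrite (subvP (addvSl _ _)) ?memv_line.
Qed.

Lemma tangent_space_exists (K : fieldType) n k (u v : 'S_n) (A : 'M[K]_(k, n)) :
  exists T : {vspace 'M[K]_(k, n)}, is_tangent_space u v A T.
Proof.
apply: vspace_of_linear_closed => [p _ | a B C TB TC p Ip].
  by rewrite big1 // => i _; rewrite big1 // => j _; rewrite mxE mulr0.
have {TB TC} := congr2 (fun b c => a * b + c) (TB p Ip) (TC p Ip).
rewrite mulr0 addr0 => eq0; rewrite -[RHS]eq0 mulr_sumr -big_split.
apply: eq_bigr => i _ /=.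
rewrite mulr_sumr -big_split; apply: eq_bigr => j _ /=.
by rewrite !mxE mulrDr mulrCA.
Qed.

Lemma minor_vanishing (K : fieldType) n k (u v : 'S_n) (I : ksubset n k) :
  I \in nonbases K k u v ->
  vanishing_ideal u v (minor I (generic_matrix K n k)).
Proof.
rewrite inE => /asboolPn notI A PA; rewrite eval_minor_generic.
by apply/eqP/negPn/negP => nzI; apply: notI; exists A.
Qed.

(** The rows of W, a basis of T, lie in the kernel of the transposed Jacobian,
    because the minors indexed by nonbases are in the vanishing ideal. *)
Lemma rank_Jac_at_le_codim (K : fieldType) n k (u v : 'S_n) (A : 'M[K]_(k, n))
    (T : {vspace 'M[K]_(k, n)}) :
  is_tangent_space u v A T ->
  (\rank (Jac_at u v A) <= \dim {:'M[K]_(k, n)} - \dim T)%N.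
Proof.
move=> tanT; pose J := Jac_at u v A.
pose W := \matrix_(i < \dim T) mxvec (vbasis T)`_i.
have W_free : row_free W.
  apply: inj_row_free => c; rewrite mulmx_sum_row => Wc0.
  apply/rowP=> i; rewrite [RHS]mxE.
  apply: (freeP (basis_free (vbasisP T)) (fun i => c 0 i)).
  apply: (can_inj mxvecK); rewrite linear0 -[RHS]Wc0 linear_sum.
  by apply: eq_bigr => l _; rewrite linearZ rowK.
have WJ0 : W *m J^T = 0.
  apply/row_matrixP=> i; rewrite row_mul rowK row0.
  apply: trmx_inj; rewrite trmx_mul trmxK trmx0; apply/colP=> r.
  have /(tanT _) tan_i : (vbasis T)`_i \in T.
    by rewrite vbasis_mem ?mem_nth ?size_tuple.
  rewrite [RHS]mxE -[RHS](tan_i _ (minor_vanishing _ _ _ _ _ _ (enum_valP r))).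
  rewrite mxE pair_bigA (reindex _ (curry_mxvec_bij k n)) /=.
  by apply: eq_bigr => -[i' j'] _; rewrite !mxE mxvecE.
have := mxrankS (introT sub_kermxP WJ0).
rewrite mxrank_ker mxrank_tr (eqP W_free) => le_T.
have dimM : \dim {:'M[K]_(k, n)} = (k * n)%N by rewrite dimvf.
by rewrite dimM leq_subRL ?rank_leq_col // addnC -leq_subRL ?rank_leq_col.
Qed.

(** * The lower bound at a point of a Schubert cell *)

Theorem theorem1p3 (R : realType) (n k : nat) (le_kn : (k <= n)%N)
    (u v y : 'S_n) (A : 'M[R[i]]_(k, n)) :
  grassmannian k v ->
  bruhat_le u v ->
  bruhat_le u y -> bruhat_le y v ->
  positroid_variety u v A ->
  (exists F : 'M[R[i]]_n,
     [/\ schubert_cell y F, opposite_schubert_variety v F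
       & represents_pi F A]) ->
  (exists2 T : {vspace 'M[R[i]]_(k, n)},
     is_tangent_space u v A T &
     (\rank (Jac_at u v (coord_point R[i] (kinitial y le_kn)))
        <= \dim {:'M[R[i]]_(k, n)} - \dim T)%N)
  /\ (\rank (Jac_at u v (coord_point R[i] (kinitial y le_kn)))
        <= \rank (Jac_at u v A))%N.
Proof.
move=> _ _ _ _ _ [F [[_ cellF] _ [_ eqAF]]].
have le_rank : (\rank (Jac_at u v (coord_point R[i] (kinitial y le_kn)))
    <= \rank (Jac_at u v A))%N.
  have [j le_jn | g ech] := echelon_form R[i] n k (kinitial y le_kn) A.
    by rewrite (rank_proj_eqmx _ _ _ _ _ _ _ eqAF) cellF.
  have g_unit := echelon_mul_unit _ _ _ _ _ _ ech.
  apply: leq_trans (rank_Jac_at_coord_le _ _ _ _ _ _ _ ech) _.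
  (* A is recovered from g A by the action of g^-1 and of the trivial torus
     element. *)
  have ginv : invmx g \in unitmx by rewrite unitmx_inv.
  have := rank_Jac_at_scale_le _ _ _ u v (invmx g) (g *m A) (const_mx 1) ginv.
  rewrite mulKmx // diag_const_mx mulmx1; apply=> j.
  by rewrite mxE oner_neq0.
split=> //; have [T tanT] := tangent_space_exists R[i] n k u v A.
exists T => //; apply: leq_trans le_rank _.
exact: rank_Jac_at_le_codim tanT.
Qed.
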